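(* Let $\Sigma$ be a finite alphabet. A language $L\subseteq\Sigma^*$ is accepted by a total alternating Turing machine over $\Sigma$ (that is, $L=\mathcal{L}(M)$ for some total ATM $M$) if and only if both $L$ and its complement $\bar L=\Sigma^*\setminus L$ are accepted by alternating Turing machines over $\Sigma$ (that is, $L=\mathcal{L}(M_0)$ and $\bar L=\mathcal{L}(N)$ for some ATMs $M_0$ and $N$).
   Context: **Alternating Turing machines.** Let $\Sigma$ be a finite alphabet. The symbols $\sqcup$ (blank), $+$ (cursor forward) and $-$ (cursor backward) are reserved (in particular they are not in $\Sigma$). An *alternating Turing machine (ATM) over $\Sigma$* is a device $M$ consisting of: disjoint finite sets $E$ (existential states) and $U$ (universal states), with $Q = E\cup U$ the set of states; a start state $s_0\in Q$; a finite alphabet $\Gamma \supseteq \Sigma\cup\{\sqcup\}$; and a relation $\delta\subseteq (Q\times\Gamma)\times(A\times Q)$, where $A=\Gamma\cup\{-,+\}$ is the set of actions. There are no designated accepting or rejecting states. A *configuration* is a tuple $(q,u,\gamma,v)$ with $q\in Q$, $u,v\in\Gamma^*$, $\gamma\in\Gamma$ ($\gamma$ is the scanned symbol). It is existential or universal according to whether $q\in E$ or $q \in U$. The yield relation $\Rightarrow$ is the least relation such that ($\varepsilon$ is the empty string): if $(q,\gamma,+,q')\in\delta$ then $(q,u,\gamma,\tau v)\Rightarrow(q',u\gamma,\tau,v)$ and $(q,u,\gamma,\varepsilon)\Rightarrow(q',u\gamma,\sqcup,\varepsilon)$; if $(q,\gamma,-,q')\in\delta$ then $(q,u\tau,\gamma,v)\Rightarrow(q',u,\tau,\gamma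 v)$ and $(q,\varepsilon,\gamma,v)\Rightarrow(q',\varepsilon,\gamma,v)$; if $(q,\gamma,\tau,q')\in\delta$ with $\tau\in\Gamma$ then $(q,u,\gamma,v)\Rightarrow(q',u,\tau,v)$. **Global acceptance and rejection.** Write $c\to_\exists c'$ when $c\Rightarrow c'$ and $c$ is existential, and $c\twoheadrightarrow_\exists c'$ when $c\to_\exists^* c'$ (reflexive-transitive closure) and $c'$ is universal. Dually, $c\to_\forall c'$ when $c\Rightarrow c'$ and $c$ is universal, and $c\twoheadrightarrow_\forall c'$ when $c\to_\forall^* c'$ and $c'$ is existential. The set $AC$ of *accepted configurations* is the least set such that: (1) if $c$ is existential and $c'\in AC$ for some $c'$ with $c\twoheadrightarrow_\exists c'$, then $c\in AC$; (2) if $c$ is universal and $c'\in AC$ for all $c'$ with $c\twoheadrightarrow_\forall c'$, then $c\in AC$. The set $RC$ of *rejected configurations* is the least set such that: (1) if $c$ is existential and $c'\in RC$ for all $c'$ with $c\twoheadrightarrow_\exists c'$, then $c\in RC$; (2) if $c$ is universal and $c'\in RC$ for some $c'$ with $c\twoheadrightarrow_\forall c'$, then $c\in RC$. The initial configuration for input $w\in\Sigma^*$ is $(s_0,\varepsilon,\sqcup,w)$. $M$ *accepts* $w$ if this configuration is in $AC$, and *rejects* $w$ if it is in $RC$. $\mathcal{L}(M)=\{w\in\Sigma^*\mid M\text{ accepts }w\}$. $M$ is *total* if every $w\in\Sigma^*$ is either accepted or rejected by $M$. *)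

(* Defs.v *)
From Stdlib Require Export Relation_Operators.
From mathcomp Require Export all_boot.
From mathcomp Require Export classical_sets.

Set Implicit Arguments.
Unset Strict Implicit.
Unset Printing Implicit Defensive.

(* The set of actions [Gamma + {-, +}]; the cursor moves are separate
   constructors, hence automatically distinct from every tape symbol. *)
Inductive action (Gamma : Type) : Type :=
| Write of Gamma
| Forward
| Backward.

Arguments Forward {Gamma}.
Arguments Backward {Gamma}.

(* The inclusion of [Sigma] plus the blank in the tape alphabet is an
   injection [letter] whose range avoids [blank].  As all types involved are
   finite, a boolean-valued [delta] is an arbitrary relation. *)
Record ATM (Sigma : finType) : Type := MkATM {
  exst : finType;
  univ : finType;
  start : exst + univ;
  tape : finType;
  letter : Sigma -> tape;
  blank : tape;
  letter_inj : injective letter;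
  letter_blank : forall a, letter a != blank;
  delta : (exst + univ) * tape -> action tape * (exst + univ) -> bool
}.

Section Semantics.

Variables (Sigma : finType) (M : ATM Sigma).

Definition state : Type := (exst M + univ M)%type.

Record config : Type := Config {
  cstate : state;
  cleft : seq (tape M);
  cscan : tape M;
  cright : seq (tape M)
}.

Definition existential (c : config) : Prop := exists q, cstate c = inl q.
Definition universal (c : config) : Prop := exists q, cstate c = inr q.

(* In [Config q u g v] the last letter of [u] is adjacent to the cursor. *)
Inductive yields : config -> config -> Prop :=
| yields_forward q u g t v q' : delta (q, g) (Forward, q') ->
    yields (Config q u g (t :: v)) (Config q' (rcons u g) t v)
| yields_forward_blank q u g q' : delta (q, g) (Forward, q') ->
    yields (Config q u g [::]) (Config q' (rcons u g) (blank M) [::])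
| yields_backward q u t g v q' : delta (q, g) (Backward, q') ->
    yields (Config q (rcons u t) g v) (Config q' u t (g :: v))
| yields_backward_end q g v q' : delta (q, g) (Backward, q') ->
    yields (Config q [::] g v) (Config q' [::] g v)
| yields_write q u g v t q' : delta (q, g) (Write t, q') ->
    yields (Config q u g v) (Config q' u t v).

Definition step_ex (c c' : config) : Prop := yields c c' /\ existential c.
Definition step_un (c c' : config) : Prop := yields c c' /\ universal c.

Definition reach_ex (c c' : config) : Prop :=
  clos_refl_trans config step_ex c c' /\ universal c'.
Definition reach_un (c c' : config) : Prop :=
  clos_refl_trans config step_un c c' /\ existential c'.

Inductive AC : config -> Prop :=
| AC_ex c c' : existential c -> reach_ex c c' -> AC c' -> AC c
| AC_un c : universal c -> (forall c', reach_un c c' -> AC c') -> AC c.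

Inductive RC : config -> Prop :=
| RC_ex c : existential c -> (forall c', reach_ex c c' -> RC c') -> RC c
| RC_un c c' : universal c -> reach_un c c' -> RC c' -> RC c.

Definition initial (w : seq Sigma) : config :=
  Config (start M) [::] (blank M) (map (@letter _ M) w).

Definition accepts (w : seq Sigma) : Prop := AC (initial w).
Definition rejects (w : seq Sigma) : Prop := RC (initial w).

Definition lang : set (seq Sigma) := [set w | accepts w]%classic.

Definition total_ATM : Prop := forall w : seq Sigma, accepts w \/ rejects w.

End Semantics.

(* Main.v *)
Require Import Defs.
From mathcomp Require Import all_boot classical_sets.
From mathcomp Require Import boolp.
From Stdlib Require Import Operators_Properties.

(* Only the converse needs an argument beyond exchanging the two players.  Given
   machines [M0] for [L] and [N] for its complement, a machine [P] plays the two
   acceptance games in parallel on a two-track tape, with the roles of the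
   players exchanged in the game of [N]: the existential player tries to show
   that [M0] accepts, the universal player that [N] accepts.  Exactly one of
   them is right.  That player follows a winning strategy in his own game,
   avoids defeat in the other one, and wins [P] after finitely many rounds, as
   the rank of the position in his own game decreases.  Hence [P] is total and
   accepts [L]. *)

Set Implicit Arguments.
Unset Strict Implicit.
Unset Printing Implicit Defensive.

Lemma rt_impl (T : Type) (R S : T -> T -> Prop) :
  (forall x y, R x y -> S x y) ->
  forall x y, clos_refl_trans T R x y -> clos_refl_trans T S x y.
Proof.
move=> RS x y; elim=> {x y} [x y xy|x|x y z _ xy _ yz].
- by apply: rt_step; apply: RS.
- exact: rt_refl.
- exact: rt_trans xy yz.
Qed.

(** * Games of two players and their winning positions *)

Section Arena.

Variables (T : Type) (owner : T -> bool) (step : T -> T -> Prop).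

Definition move (p : bool) (c c' : T) : Prop := step c c' /\ owner c = p.

Definition reach (p : bool) (c c' : T) : Prop :=
  clos_refl_trans T (move p) c c' /\ owner c' = ~~ p.

(** Covers [AC] ([p] true) and [RC] ([p] false) at once, so that each argument serves both
    players. *)
Inductive wins (p : bool) : T -> Prop :=
| wins_own c c' : owner c = p -> reach p c c' -> wins p c' -> wins p c
| wins_opp c : owner c = ~~ p -> (forall c', reach (~~ p) c c' -> wins p c') ->
    wins p c.

(** At every position one derivation chooses a play and the other covers all such plays, so both can
    be followed along it; induction on one of them ends this. *)
Lemma wins_disjoint p c : wins p c -> ~ wins (~~ p) c.
Proof.
elim=> {c} [c c' oc r _ IH | c oc _ IH] w.
- case: w oc r => {c} [c c'' -> _ _ | c _ H oc r].
    by case: (p).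
  by apply: IH; apply: H; rewrite negbK.
- case: w oc IH => {c} [c c'' _ r w _ IH | c -> _].
    exact: IH r w.
  by case: (p).
Qed.

Lemma reach_stuck p c c' : owner c = ~~ p -> reach p c c' -> c' = c.
Proof.
move=> oc [/(clos_rt_rt1n _ _ _ _) r _].
by case: r oc => // y z [_ ->] _; case: (p).
Qed.

Lemma reach_self p c : owner c = ~~ p -> reach p c c.
Proof. by move=> oc; split=> //; apply: rt_refl. Qed.

(** Plays of the owner from [c] are those from [d] preceded by one step: as they end at a change of
    owner, they are not empty. *)
Lemma wins_forced p c d :
  owner c = owner d -> (forall e, step c e <-> e = d) -> wins p d -> wins p c.
Proof.
move=> ocd Hc w; case: w ocd Hc => {d} d.
  move=> d' od [r od'] w ocd Hc; apply: wins_own w; first by rewrite ocd.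
  split=> //; apply: rt_trans r; apply: rt_step.
  by split; [apply/Hc | rewrite ocd].
move=> od H ocd Hc; apply: wins_opp => [|c' [/(clos_rt_rt1n _ _ _ _) r oc']]; first by rewrite ocd.
case: r oc' => [|y z [/Hc -> _] /(clos_rt1n_rt _ _ _ _) r] oc'; last exact: H.
by move: oc'; rewrite ocd od; case: (p).
Qed.

(** A position may be won by neither player, so only avoiding defeat is claimed. If every play of
    [p] led to a win of the opponent, [wins_opp] would make [c] such a win. *)
Lemma not_wins_escape p c :
  ~ wins (~~ p) c -> exists2 c', reach p c c' & ~ wins (~~ p) c'.
Proof.
move=> nw; have [oc|oc] := eqVneq (owner c) p; last first.
  by exists c => //; apply: reach_self; move: oc; case: (owner c); case: (p).
apply: contrapT => H; apply: nw; apply: wins_opp; first by rewrite negbK.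
rewrite negbK => c' r; apply: contrapT => nw; apply: H.
by exists c'.
Qed.

(** A play of [p] into a win is already a win at its start; if the opponent owns the start, the play
    is empty. *)
Lemma not_wins_reach p c c' :
  ~ wins p c -> reach p c c' -> ~ wins p c'.
Proof.
move=> nw r w; apply: nw; have [oc|oc] := eqVneq (owner c) p.
  exact: wins_own r w.
suff -> : c = c' by [].
apply/esym; apply: reach_stuck r.
by move: oc; case: (owner c); case: (p).
Qed.

End Arena.

(** * Bisimulations, possibly exchanging the players, preserve winning *)

Section Bisimulation.

Variables (T U : Type) (oT : T -> bool) (oU : U -> bool).
Variables (sT : T -> T -> Prop) (sU : U -> U -> Prop) (neg : bool).
Variable R : T -> U -> Prop.
Hypothesis RO : forall x y, R x y -> oT x = neg (+) oU y.
Hypothesis RF : forall x y x', R x y -> sT x x' -> exists2 y', sU y y' & R x' y'.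
Hypothesis RB : forall x y y', R x y -> sU y y' -> exists2 x', sT x x' & R x' y'.

(** Player [neg (+) p] of the first game corresponds to player [p] of the second; [neg] is true for
    the dual machine below. *)
Lemma bisim_reachF p x y x' : R x y -> reach oT sT (neg (+) p) x x' ->
  exists2 y', reach oU sU p y y' & R x' y'.
Proof.
move=> Rxy [/(clos_rt_rt1n _ _ _ _) r ox'].
suff [y' r' R'] : exists2 y', clos_refl_trans _ (move oU sU p) y y' & R x' y'.
  exists y' => //; split=> //.
  by move: ox'; rewrite (RO R'); case: (neg); case: (p); case: (oU y').
elim: r y Rxy {ox'} => [z|z z' z'' [s o] _ IH] y Rzy.
  by exists y => //; apply: rt_refl.
have [y1 s1 R1] := RF Rzy s; have [y' r' R'] := IH _ R1.
exists y' => //; apply: rt_trans r'; apply: rt_step; split=> //.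
by move: o; rewrite (RO Rzy); case: (neg); case: (p); case: (oU y).
Qed.

Lemma bisim_reachB p x y y' : R x y -> reach oU sU p y y' ->
  exists2 x', reach oT sT (neg (+) p) x x' & R x' y'.
Proof.
move=> Rxy [/(clos_rt_rt1n _ _ _ _) r oy'].
suff [x' r' R'] : exists2 x', clos_refl_trans _ (move oT sT (neg (+) p)) x x'
                             & R x' y'.
  by exists x' => //; split=> //; rewrite (RO R') oy'; case: (neg); case: (p).
elim: r x Rxy {oy'} => [z|z z' z'' [s o] _ IH] x Rxz.
  by exists x => //; apply: rt_refl.
have [x1 s1 R1] := RB Rxz s; have [x' r' R'] := IH _ R1.
exists x' => //; apply: rt_trans r'; apply: rt_step; split=> //.
by rewrite (RO Rxz) o.
Qed.

Lemma bisim_winsF p x y :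
  R x y -> wins oT sT (neg (+) p) x -> wins oU sU p y.
Proof.
move=> Rxy w; elim: w y Rxy => {x} [x x' ox r _ IH | x ox _ IH] y Rxy.
  have [y' r' R'] := bisim_reachF Rxy r.
  apply: wins_own r' (IH _ R').
  by move: ox; rewrite (RO Rxy); case: (neg); case: (p); case: (oU y).
apply: wins_opp => [|y' r'].
  by move: ox; rewrite (RO Rxy); case: (neg); case: (p); case: (oU y).
have [x' r R'] := bisim_reachB Rxy r'.
by apply: IH R'; rewrite -addbN.
Qed.

Lemma bisim_winsB p x y :
  R x y -> wins oU sU p y -> wins oT sT (neg (+) p) x.
Proof.
move=> Rxy w; elim: w x Rxy => {y} [y y' oy r _ IH | y oy _ IH] x Rxy.
  have [x' r' R'] := bisim_reachB Rxy r.
  by apply: wins_own r' (IH _ R'); rewrite (RO Rxy) oy.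
apply: wins_opp => [|x']; first by rewrite (RO Rxy) oy addbN.
rewrite -addbN => r'; have [y' r R'] := bisim_reachF Rxy r'.
exact: IH R'.
Qed.

Lemma bisim_wins p x y :
  R x y -> wins oT sT (neg (+) p) x <-> wins oU sU p y.
Proof. by move=> Rxy; split; [apply: bisim_winsF|apply: bisim_winsB]. Qed.

End Bisimulation.

(** * Acceptance and rejection as winning in the game of configurations *)

Definition is_inl (A B : Type) (s : A + B) : bool :=
  if s is inl _ then true else false.

Section Configurations.

Variables (Sigma : finType) (M : ATM Sigma).

Definition cowner (c : config M) : bool := is_inl (cstate c).

Lemma existentialE (c : config M) : existential c <-> cowner c = true.
Proof.
rewrite /existential /cowner; case: (cstate c) => q; split=> //=.
- by exists q.
- by case.
Qed.

Lemma universalE (c : config M) : universal c <-> cowner c = false.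
Proof.
rewrite /universal /cowner; case: (cstate c) => q; split=> //=.
- by case.
- by exists q.
Qed.

Lemma reach_exE (c c' : config M) :
  reach_ex c c' <-> reach cowner (@yields _ M) true c c'.
Proof.
split=> -[r /universalE o]; split=> //; apply: rt_impl r => x y [s] /existentialE.
all: by split.
Qed.

Lemma reach_unE (c c' : config M) :
  reach_un c c' <-> reach cowner (@yields _ M) false c c'.
Proof.
split=> -[r /existentialE o]; split=> //; apply: rt_impl r => x y [s] /universalE.
all: by split.
Qed.

Lemma ACE (c : config M) : Defs.AC c <-> wins cowner (@yields _ M) true c.
Proof.
split; elim=> {c} [c c'|c].
- by move=> /existentialE o /reach_exE r _; apply: wins_own.
- by move=> /universalE o _ IH; apply: wins_opp => // c' /reach_unE; apply: IH.
- by move=> /existentialE o /reach_exE r _; apply: AC_ex.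
- by move=> /universalE o _ IH; apply: AC_un => // c' /reach_unE; apply: IH.
Qed.

Lemma RCE (c : config M) : RC c <-> wins cowner (@yields _ M) false c.
Proof.
split; elim=> {c}.
- by move=> c /existentialE o _ IH; apply: wins_opp => // c' /reach_exE; apply: IH.
- by move=> c c' /universalE o /reach_unE r _; apply: wins_own.
- by move=> c c' /universalE o /reach_unE r _; apply: RC_un.
- by move=> c /existentialE o _ IH; apply: RC_ex => // c' /reach_exE; apply: IH.
Qed.

(* Reading the tape as a function on positions identifies configurations that
   differ by trailing blanks only. *)
Record fconfig : Type := FConfig {
  fstate : state M;
  ftape : nat -> tape M;
  fpos : nat
}.

Definition fowner (x : fconfig) : bool := is_inl (fstate x).

(** The truncated predecessor, with [0.-1 = 0], models the backward move at the left end. *)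
Definition exec (x : fconfig) (a : action (tape M)) (q : state M) : fconfig :=
  match a with
  | Forward => FConfig q (ftape x) (fpos x).+1
  | Backward => FConfig q (ftape x) (fpos x).-1
  | Write t => FConfig q (fun i => if i == fpos x then t else ftape x i) (fpos x)
  end.

Definition fstep (x y : fconfig) : Prop :=
  exists a q, delta (fstate x, ftape x (fpos x)) (a, q) /\ y = exec x a q.

Definition denote (c : config M) : fconfig :=
  FConfig (cstate c) (nth (blank M) (cleft c ++ cscan c :: cright c))
    (size (cleft c)).

Lemma nth_scan (c : config M) :
  ftape (denote c) (fpos (denote c)) = cscan c.
Proof. by rewrite /= nth_cat ltnn subnn. Qed.

(** Accounts for the blank appended by [yields_forward_blank]. *)
Lemma nth_blank_cat (s : seq (tape M)) :
  nth (blank M) (s ++ [:: blank M]) = nth (blank M) s.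
Proof.
apply/funext => i; rewrite nth_cat; case: ltnP => // si.
by rewrite [RHS]nth_default //; case: (i - _) => [|[]].
Qed.

Lemma nth_write (u v : seq (tape M)) g t :
  nth (blank M) (u ++ t :: v) =
  fun i => if i == size u then t else nth (blank M) (u ++ g :: v) i.
Proof.
apply/funext => i; rewrite !nth_cat; case: (ltngtP i (size u)) => //.
- by rewrite -subn_gt0; case: (i - _).
- by move=> ->; rewrite subnn.
Qed.

Lemma denote_yields c c' : yields c c' -> fstep (denote c) (denote c').
Proof.
case=> [q u g t v q' d|q u g q' d|q u t g v q' d|q g v q' d|q u g v t q' d].
all: eexists _, q'; split; first by rewrite nth_scan; exact: d.
all: rewrite /denote /exec /= ?size_rcons ?cat_rcons //.
- by rewrite -cat_rcons nth_blank_cat cats1.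
- by rewrite (nth_write _ _ g).
Qed.

Lemma denote_fstep c y :
  fstep (denote c) y -> exists2 c', yields c c' & denote c' = y.
Proof.
case: c => q u g v [a [q' []]]; rewrite nth_scan /=; case: a => [t||] d ->.
- exists (Config q' u t v); first exact: yields_write.
  by rewrite /denote /exec /= (nth_write _ _ g).
- case: v => [|t v].
    exists (Config q' (rcons u g) (blank M) [::]).
      exact: yields_forward_blank.
    by rewrite /denote /exec /= size_rcons nth_blank_cat cats1.
  exists (Config q' (rcons u g) t v); first exact: yields_forward.
  by rewrite /denote /exec /= size_rcons cat_rcons.
- case/lastP: u => [|u t].
    by exists (Config q' [::] g v); first exact: yields_backward_end.
  exists (Config q' u t (g :: v)); first exact: yields_backward.
  by rewrite /denote /exec /= size_rcons cat_rcons.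
Qed.

(** The graph of [denote] is a bisimulation that preserves owners. *)
Lemma denote_wins p c :
  wins cowner (@yields _ M) p c <-> wins fowner fstep p (denote c).
Proof.
apply: (@bisim_wins _ _ cowner fowner _ fstep false (fun c x => denote c = x)).
- by move=> x _ <-.
- by move=> x _ x' <- /denote_yields s; exists (denote x').
- by move=> x _ y' <- /denote_fstep [x' s <-]; exists x'.
- by [].
Qed.

Lemma acceptsE w : accepts M w <-> wins fowner fstep true (denote (initial M w)).
Proof. by rewrite -denote_wins -ACE. Qed.

Lemma rejectsE w : rejects M w <-> wins fowner fstep false (denote (initial M w)).
Proof. by rewrite -denote_wins -RCE. Qed.

Lemma not_accepts_rejects w : accepts M w -> ~ rejects M w.
Proof. by rewrite acceptsE rejectsE; apply: wins_disjoint. Qed.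

End Configurations.

(** * Exchanging existential and universal states *)

Section Dual.

Variables (Sigma : finType) (M : ATM Sigma).

Definition swap (A B : Type) (s : A + B) : B + A :=
  match s with inl a => inr a | inr b => inl b end.

(** Exchanging the two kinds of states makes each player take over the role of the other, which
    exchanges acceptance and rejection. *)
Definition dual : ATM Sigma :=
  @MkATM Sigma (univ M) (exst M) (swap (start M)) (tape M) (@letter _ M)
    (blank M) (@letter_inj _ M) (@letter_blank _ M)
    (fun x y => delta (swap x.1, x.2) (y.1, swap y.2)).

Lemma swapK (A B : Type) : cancel (@swap A B) (@swap B A).
Proof. by case. Qed.

Definition fdual (x : fconfig M) : fconfig dual :=
  @FConfig _ dual (swap (fstate x)) (ftape x) (fpos x).

Lemma fdual_exec x a q :
  fdual (exec x a q) = exec (fdual x) (a : action (tape dual)) (swap q).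
Proof. by case: a. Qed.

Lemma fdual_wins p x :
  wins (@fowner _ M) (@fstep _ M) (~~ p) x <->
  wins (@fowner _ dual) (@fstep _ dual) p (fdual x).
Proof.
apply: (@bisim_wins _ _ (@fowner _ M) (@fowner _ dual) _ (@fstep _ dual) true
          (fun x y => fdual x = y)) => //.
- by move=> {}x _ <-; rewrite /fowner /=; case: (fstate x).
- move=> {}x _ _ <- [a [q [d ->]]]; exists (fdual (exec x a q)) => //.
  exists a, (swap q); split; last exact: fdual_exec.
  by rewrite /= !swapK.
- move=> {}x _ _ <- [a [q [d ->]]]; exists (exec x a (swap q)).
    by exists a, (swap q); split=> //; move: d; rewrite /= swapK.
  by rewrite fdual_exec swapK.
Qed.

Lemma dual_accepts w : accepts dual w <-> rejects M w.
Proof. by rewrite acceptsE rejectsE; apply: iff_sym; exact: (fdual_wins true). Qed.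

Lemma dual_rejects w : rejects dual w <-> accepts M w.
Proof. by rewrite acceptsE rejectsE; apply: iff_sym; exact: (fdual_wins false). Qed.

End Dual.

(** * Pairs indexed by the players *)

Section Pairs.

Variable F : bool -> Type.

(** The booleans name both the players and their tracks, so statements about [p] and [~~ p] treat
    both cases together, although the two machines have different types. *)
Definition sel (x : F true * F false) (b : bool) : F b :=
  match b with true => x.1 | false => x.2 end.

Definition put (x : F true * F false) (b : bool) : F b -> F true * F false :=
  match b with true => fun v => (v, x.2) | false => fun v => (x.1, v) end.

Lemma sel_put x b v : sel (@put x b v) b = v.
Proof. by case: b v. Qed.

Lemma sel_put_neq x b b' v : b' != b -> sel (@put x b v) b' = sel x b'.
Proof. by case: b v; case: b'. Qed.

End Pairs.

Arguments sel {F} x b.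
Arguments put {F} x b v.

(** * The machine playing two games in parallel *)

Section Product.

Variables (Sigma : finType) (G : bool -> ATM Sigma).

Definition track_symbol (b : bool) : Type := (tape (G b) * bool)%type.

Local Notation states := (state (G true) * state (G false))%type.
Local Notation cell := (track_symbol true * track_symbol false)%type.
Local Notation fconfigs := (fconfig (G true) * fconfig (G false))%type.
Local Notation selq := (@sel (fun b => state (G b))).
Local Notation putq := (@put (fun b => state (G b))).
Local Notation selt := (@sel track_symbol).
Local Notation putt := (@put track_symbol).
Local Notation self := (@sel (fun b => fconfig (G b))).
Local Notation putf := (@put (fun b => fconfig (G b))).
Local Notation moves p b := (move (@fowner _ (G b)) (@fstep _ (G b)) p).
Local Notation reaches p b := (reach (@fowner _ (G b)) (@fstep _ (G b)) p).

(* A mode is encoded as an [option (option bool)] to inherit finiteness. *)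
Local Notation mode := (option (option bool)).
Local Notation Init := (None : mode).
Local Notation Seek := (Some None : mode).
Local Notation Run b := (Some (Some b) : mode).

(* Besides two-track cells, each symbol carrying a mark for a suspended head,
   the tape alphabet contains the input letters and the blank; these stand for
   cells with the same symbol on both tracks, so the input need not be
   preprocessed. *)
Definition prod_tape : finType :=
  (option Sigma +
   ((tape (G true) * bool) * (tape (G false) * bool)))%type.

(** The phase is not stored here: existential and universal states are two copies of this type, and
    the copy tells whose phase it is. *)
Definition prod_control : finType :=
  ((exst (G true) + univ (G true)) * (exst (G false) + univ (G false)) *
   option (option bool))%type.

Definition input_symbol (b : bool) (o : option Sigma) : tape (G b) :=
  if o is Some a then @letter _ (G b) a else blank (G b).

Definition decode (s : prod_tape) : cell :=
  match s with
  | inl o => ((input_symbol true o, false), (input_symbol false o, false))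
  | inr v => v
  end.

Definition stamp (b m : bool) (g : cell) : action prod_tape :=
  Write (inr (putt g b ((selt g b).1, m)) : prod_tape).

(** The mark written is [false] because the head of the running track is the cursor itself. *)
Definition lift_action (b : bool) (g : cell) (a : action (tape (G b))) :
    action prod_tape :=
  match a with
  | Forward => Forward
  | Backward => Backward
  | Write t => Write (inr (putt g b (t, false)) : prod_tape)
  end.

(* In phase [p], player [p] moves on track [p], then looks for the mark of the
   other head and moves on track [~~ p], and then passes the turn to [~~ p].
   The search is nondeterministic: a player who never finds the mark loses. *)
Inductive rule (p : bool) (qs : states) (g : cell) :
    mode -> action prod_tape -> bool -> states -> mode -> Prop :=
| rule_init : rule p qs g Init (stamp (~~ p) true g) p qs (Run p)
| rule_run b a q' : is_inl (selq qs b) = p ->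
    delta (selq qs b, (selt g b).1) (a, q') ->
    rule p qs g (Run b) (lift_action g a) p (putq qs b q') (Run b)
| rule_suspend : is_inl (selq qs p) = ~~ p ->
    rule p qs g (Run p) (stamp p true g) p qs Seek
| rule_forward : rule p qs g Seek Forward p qs Seek
| rule_backward : rule p qs g Seek Backward p qs Seek
| rule_resume : (selt g (~~ p)).2 ->
    rule p qs g Seek (stamp (~~ p) false g) p qs (Run (~~ p))
| rule_pass : is_inl (selq qs (~~ p)) = ~~ p ->
    rule p qs g (Run (~~ p)) (stamp (~~ p) false g) (~~ p) qs (Run (~~ p)).

Definition content (s : prod_control + prod_control) : prod_control :=
  match s with inl c | inr c => c end.

Definition with_phase (p : bool) (c : prod_control) : prod_control + prod_control :=
  if p then inl c else inr c.

Lemma content_with_phase p c : content (with_phase p c) = c.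
Proof. by case: p. Qed.

Lemma is_inl_with_phase p c : is_inl (with_phase p c) = p.
Proof. by case: p. Qed.

Lemma with_phaseE s : s = with_phase (is_inl s) (content s).
Proof. by case: s. Qed.

Definition prod_letter (a : Sigma) : prod_tape := inl (Some a).

Lemma prod_letter_inj : injective prod_letter.
Proof. by move=> a b []. Qed.

Lemma prod_letter_blank a : prod_letter a != inl None.
Proof. by []. Qed.

Definition prod_ATM : ATM Sigma :=
  @MkATM Sigma prod_control prod_control
    (with_phase true (start (G true), start (G false), Init))
    prod_tape prod_letter (inl None) prod_letter_inj prod_letter_blank
    (fun x y => `[< rule (is_inl x.1) (content x.1).1 (decode x.2)
                     (content x.1).2 y.1
                     (is_inl y.2) (content y.2).1 (content y.2).2 >]).

(** * Pairs of game positions represented by a product configuration *)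

Local Notation pconfig := (fconfig prod_ATM).
Local Notation powner := (@fowner _ prod_ATM).
Local Notation pstep := (@fstep _ prod_ATM).
Local Notation pmove p := (move powner pstep p).
Local Notation preach p := (reach powner pstep p).

Definition pstates (x : pconfig) : states := (content (fstate x)).1.
Definition pmode (x : pconfig) : mode := (content (fstate x)).2.
Definition scanned (x : pconfig) : cell := decode (ftape x (fpos x)).

Lemma pstepE x y : pstep x y <-> exists a p qs m,
  rule (powner x) (pstates x) (scanned x) (pmode x) a p qs m /\
  y = exec x a (with_phase p (qs, m)).
Proof.
split=> [[a [q [/asboolP r ->]]]|[a [p [qs [m [r ->]]]]]].
  exists a, (is_inl q), (content q).1, (content q).2; split; first exact: r.
  by rewrite -surjective_pairing -with_phaseE.
exists a, (with_phase p (qs, m)); split=> //; apply/asboolP.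
by rewrite /= content_with_phase is_inl_with_phase.
Qed.

Lemma powner_exec (x : pconfig) a p c : powner (exec x a (with_phase p c)) = p.
Proof. by case: a => [t||]; apply: is_inl_with_phase. Qed.

Lemma pmode_exec (x : pconfig) a p c : pmode (exec x a (with_phase p c)) = c.2.
Proof. by case: a => [t||]; rewrite /pmode /= content_with_phase. Qed.

Lemma pstates_exec (x : pconfig) a p c : pstates (exec x a (with_phase p c)) = c.1.
Proof. by case: a => [t||]; rewrite /pstates /= content_with_phase. Qed.

(** The cursor can serve one track at a time; the head of a suspended track, with [m] true, is
    remembered only by its mark. *)
Definition shows (b : bool) (x : pconfig) (c : fconfig (G b)) (m : bool) : Prop :=
  selq (pstates x) b = fstate c /\
  forall i, selt (decode (ftape x i)) b = (ftape c i, m && (i == fpos c)).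

Definition represents (x : pconfig) (c : fconfigs) (mk : pred bool) : Prop :=
  forall b, shows x (self c b) (mk b).

Lemma represents_eq x c mk mk' :
  mk =1 mk' -> represents x c mk -> represents x c mk'.
Proof. by move=> e r b; rewrite -e. Qed.

(** The hypothesis on [fpos] puts the cursor on the head of track [b], the only cell where a mark of
    that track may stand. *)
Lemma represents_stamp x c mk b m p md :
  fpos x = fpos (self c b) -> represents x c mk ->
  represents (exec x (stamp b m (scanned x)) (with_phase p (pstates x, md))) c
    (fun b' => if b' == b then m else mk b').
Proof.
move=> pb r b'; have [rq rt] := r b'; split; first by rewrite pstates_exec.
move=> i /=; case: (eqVneq i) => [->|ni] /=.
  case: (eqVneq b' b) => [eb|nb]; last by rewrite sel_put_neq //; apply: rt.
  by subst b'; rewrite sel_put /scanned rt pb eqxx !andbT.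
rewrite rt; case: (eqVneq b' b) => // eb; rewrite eb -pb.
by rewrite (negPf ni) !andbF.
Qed.

(** [running], [seeking] and [starting] are the invariants of the three modes. They differ in the
    marked heads: the one off track [b], both, and none. *)
Definition running p b x c : Prop :=
  [/\ powner x = p, pmode x = Run b, fpos x = fpos (self c b)
    & represents x c (predC1 b)].

Definition seeking p x c : Prop :=
  [/\ powner x = p, pmode x = Seek & represents x c predT].

Definition starting p x c : Prop :=
  [/\ powner x = p, pmode x = Init, forall b, fpos x = fpos (self c b)
    & represents x c pred0].

(** * Carrying out a phase in the product *)

Lemma running_run p b x c a q' :
  running p b x c ->
  running p b
    (exec x (lift_action (scanned x) a)
       (with_phase p (putq (pstates x) b q', Run b)))
    (putf c b (exec (self c b) a q')).
Proof.
move=> [ox mx px r]; split; rewrite ?powner_exec ?pmode_exec //.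
  by rewrite sel_put; case: a => [t||] /=; rewrite px.
move=> b'; have [rq rt] := r b'; rewrite /shows pstates_exec /=.
case: (eqVneq b' b) => [eb|nb].
  subst b'; rewrite /= eqxx /= in rq rt *; rewrite !sel_put.
  split; first by case: (a).
  case: a => [t||] i //=; rewrite -px; case: (eqVneq i) => //= _.
  by rewrite sel_put.
rewrite !sel_put_neq //; split=> // i; transitivity (selt (decode (ftape x i)) b').
  2: by rewrite rt /= nb.
case: a => [t||] //=; case: (eqVneq i) => [->|] //=.
by rewrite sel_put_neq.
Qed.

(** The mark [b != b] is [predC1 b b], the form in which [running] supplies it. *)
Lemma fconfig_delta x b c a q' : shows x c (b != b) -> fpos x = fpos c ->
  delta (selq (pstates x) b, (selt (scanned x) b).1) (a, q') =
  delta (fstate c, ftape c (fpos c)) (a, q').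
Proof. by move=> [-> rt] px; rewrite /scanned rt -px. Qed.

Lemma running_pmove p b x c d :
  running p b x c -> moves p b (self c b) d ->
  exists2 y, pmove p x y & running p b y (putf c b d).
Proof.
move=> rx; have [ox mx px r] := rx.
case=> [[a [q' [da ->]]] oc].
exists (exec x (lift_action (scanned x) a)
          (with_phase p (putq (pstates x) b q', Run b))).
  split=> //; apply/pstepE; do 4 eexists; split; last reflexivity.
  rewrite ox mx; apply: rule_run; first by case: (r b) => ->.
  by rewrite (fconfig_delta _ _ (r b)).
exact: running_run.
Qed.

Lemma putf_self (c : fconfigs) b : putf c b (self c b) = c.
Proof. by case: c => c1 c2; case: b. Qed.

Lemma putf_putf (c : fconfigs) b d e : putf (putf c b d) b e = putf c b e.
Proof. by case: c => c1 c2; case: b d e. Qed.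

Lemma running_pmoves p b x c d :
  running p b x c -> clos_refl_trans _ (moves p b) (self c b) d ->
  exists2 y, clos_refl_trans _ (pmove p) x y & running p b y (putf c b d).
Proof.
move=> rx /(clos_rt_rt1n _ _ _ _) r.
move: {-2}(self c b) (erefl (self c b)) r => e ec r.
elim: r c x ec rx => {e d} [e|e e' d m _ IH] c x ec rx.
  by exists x; [apply: rt_refl | rewrite ec putf_self].
rewrite ec in m; have [y xy ry] := running_pmove rx m.
have [|z yz rz] := IH _ _ _ ry; first by rewrite sel_put.
exists z; last by rewrite putf_putf in rz.
by apply: rt_trans yz; apply: rt_step.
Qed.

Lemma pmove_rule p x a qs m :
  powner x = p -> rule p (pstates x) (scanned x) (pmode x) a p qs m ->
  pmove p x (exec x a (with_phase p (qs, m))).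
Proof.
by move=> <- r; split=> //; apply/pstepE; do 4 eexists; split; first exact: r.
Qed.

Lemma running_moves p b x c a q' :
  running p b x c -> is_inl (selq (pstates x) b) = p ->
  delta (selq (pstates x) b, (selt (scanned x) b).1) (a, q') ->
  moves p b (self c b) (exec (self c b) a q').
Proof.
move=> [_ _ px r] oq; rewrite (fconfig_delta _ _ (r b)) // => da.
by split; [exists a, q' | rewrite /fowner -(proj1 (r b))].
Qed.

Lemma seeking_cursor p x c a :
  seeking p x c -> (if a is Write _ then False else True) ->
  seeking p (exec x a (with_phase p (pstates x, Seek))) c.
Proof.
move=> [ox mx r] na; split; rewrite ?powner_exec ?pmode_exec // => b.
have [rq rt] := r b; split; first by rewrite pstates_exec.
by case: a na.
Qed.

Lemma running_suspend p x c :
  running p p x c ->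
  seeking p (exec x (stamp p true (scanned x))
               (with_phase p (pstates x, Seek))) c.
Proof.
move=> [ox mx px r]; split; rewrite ?powner_exec ?pmode_exec //.
apply: represents_eq (represents_stamp _ _ _ px r) => b /=.
by case: eqP.
Qed.

Lemma seeking_pos p x c : seeking p x c -> forall n,
  exists y, [/\ clos_refl_trans _ (pmove p) x y, seeking p y c & fpos y = n].
Proof.
pose goto k := exists y,
  [/\ clos_refl_trans _ (pmove p) x y, seeking p y c & fpos y = k].
move=> sx; have g0 : goto (fpos x) by exists x; split=> //; apply: rt_refl.
have gS k : goto k -> goto k.+1.
  move=> [y [xy [oy my r] <-]].
  exists (exec y Forward (with_phase p (pstates y, Seek))); split=> //.
    apply: rt_trans xy _; apply/rt_step/pmove_rule => //.
    by rewrite my; apply: rule_forward.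
  exact: seeking_cursor.
have gP k : goto k -> goto k.-1.
  move=> [y [xy [oy my r] <-]].
  exists (exec y Backward (with_phase p (pstates y, Seek))); split=> //.
    apply: rt_trans xy _; apply/rt_step/pmove_rule => //.
    by rewrite my; apply: rule_backward.
  exact: seeking_cursor.
move=> n; suff {n} g n : goto n by exact: g.
(* Position 0 is reached by going back from [fpos x], and [n] by then going forward. *)
elim: n => [|n IH]; last exact: gS.
by elim: (fpos x) g0 => // k IH /gP.
Qed.

Lemma seeking_resume p x c :
  seeking p x c -> fpos x = fpos (self c (~~ p)) ->
  running p (~~ p) (exec x (stamp (~~ p) false (scanned x))
               (with_phase p (pstates x, Run (~~ p)))) c.
Proof.
move=> [ox mx r] px; split; rewrite ?powner_exec ?pmode_exec //.
apply: represents_eq (represents_stamp _ _ _ px r) => b /=.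
by case: eqP.
Qed.

(** The mark is already absent; the stamp only provides an action. For the new owner the result is
    the beginning of a phase. *)
Lemma running_pass p x c :
  running p (~~ p) x c ->
  running (~~ p) (~~ p) (exec x (stamp (~~ p) false (scanned x))
               (with_phase (~~ p) (pstates x, Run (~~ p)))) c.
Proof.
move=> [ox mx px r]; split; rewrite ?powner_exec ?pmode_exec //.
apply: represents_eq (represents_stamp _ _ _ px r) => b /=.
by case: eqP.
Qed.

Lemma starting_init p x c :
  starting p x c ->
  running p p (exec x (stamp (~~ p) true (scanned x))
               (with_phase p (pstates x, Run p))) c.
Proof.
move=> [ox mx px r]; split; rewrite ?powner_exec ?pmode_exec //=.
apply: represents_eq (represents_stamp _ _ _ (px _) r) => b /=.
by case: p {ox r}; case: b.
Qed.

(** Player [p] plays on track [p], suspends, seeks the other mark, resumes, plays there and passes.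
    Suspending and passing are allowed because both plays end at positions of the opponent. *)
Lemma running_reach p x c d :
  running p p x c -> (forall b, reaches p b (self c b) (self d b)) ->
  exists2 y, preach p x y & running (~~ p) (~~ p) y d.
Proof.
move=> rx cd; have [rp op] := cd p; have [rn on] := cd (~~ p).
have [x1 s1 r1] := running_pmoves rx rp.
have r2 := running_suspend r1; set x2 := exec _ _ _ in r2.
have s2 : pmove p x1 x2.
  have [ox mx px r] := r1; apply: pmove_rule => //; rewrite mx.
  apply: rule_suspend; have [-> _] := r p.
  by rewrite sel_put.
have [x3 [s3 r3 px3]] :=
  seeking_pos r2 (fpos (self (putf c p (self d p)) (~~ p))).
have r4 := seeking_resume r3 px3; set x4 := exec _ _ _ in r4.
have s4 : pmove p x3 x4.
  have [ox mx r] := r3; apply: pmove_rule => //; rewrite mx.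
  apply: rule_resume; have [_] := r (~~ p); rewrite /scanned => ->.
  by rewrite px3 eqxx.
have nn : ~~ p != p by case: (p).
have [|x5 s5 r5] := running_pmoves r4 (d := self d (~~ p)).
  by rewrite sel_put_neq.
have r6 := running_pass r5; set x6 := exec _ _ _ in r6.
have s6 : pmove p x5 x6.
  have [ox mx px r] := r5; split=> //; apply/pstepE.
  do 4 eexists; split; last reflexivity.
  rewrite ox mx; apply: rule_pass; have [-> _] := r (~~ p).
  by rewrite sel_put.
have ed : putf (putf c p (self d p)) (~~ p) (self d (~~ p)) = d.
  by case: (p) (d) => -[].
rewrite ed in r6; exists x6; last exact: r6.
split; last by case: r6.
apply: rt_trans s1 _; apply: rt_trans (rt_step _ _ _ _ s2) _.
apply: rt_trans s3 _; apply: rt_trans (rt_step _ _ _ _ s4) _.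
by apply: rt_trans s5 _; apply: rt_step.
Qed.

(** * Every completed phase comes from a play on each track *)

Inductive progress (p : bool) (c : fconfigs) (x : pconfig) : Prop :=
| progress_own d : running p p x d -> self d (~~ p) = self c (~~ p) ->
    clos_refl_trans _ (moves p p) (self c p) (self d p) -> progress p c x
| progress_seek d : seeking p x d -> self d (~~ p) = self c (~~ p) ->
    reaches p p (self c p) (self d p) -> progress p c x
| progress_other d : running p (~~ p) x d ->
    clos_refl_trans _ (moves p (~~ p)) (self c (~~ p)) (self d (~~ p)) ->
    reaches p p (self c p) (self d p) -> progress p c x
| progress_done d : running (~~ p) (~~ p) x d ->
    (forall b, reaches p b (self c b) (self d b)) -> progress p c x.

(** The constructors of [progress] are the successive stages of a phase of [p] begun at [c];
    inversion of [rule] shows that a move stays in its stage or enters the next. *)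
Lemma progress_pmove p c x y : progress p c x -> pmove p x y -> progress p c y.
Proof.
have nn : ~~ p != p by case: (p).
have np : ~~ p <> p by apply/eqP.
move=> P [/pstepE [a [p' [qs [m [R ->]]]]] opx]; rewrite opx in R.
case: P => d rx => [e r|e r|r1 r2|r].
- have [_ mx px rp] := rx; rewrite mx {opx} in R.
  inversion R as [|b a' q' oq da| | | | |]; subst.
  + apply: (progress_own (running_run _ _ rx)); first by rewrite sel_put_neq.
    by rewrite sel_put; apply: rt_trans r _; apply: rt_step; exact: running_moves rx oq da.
  + apply: (progress_seek (running_suspend rx) e); split=> //.
    by rewrite /fowner -(proj1 (rp _)).
  + congruence.
- have [_ mx rp] := rx; rewrite mx {opx} in R.
  inversion R as [| | | | |mk|]; subst.
  + by apply: progress_seek e r; apply: seeking_cursor.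
  + by apply: progress_seek e r; apply: seeking_cursor.
  + apply: (progress_other (seeking_resume rx _)) r => //.
      by move: mk; rewrite /scanned (proj2 (rp _)) => /eqP.
    by rewrite e; apply: rt_refl.
- have [_ mx px rp] := rx; rewrite mx {opx} in R.
  inversion R as [|b a' q' oq da| | | | |]; subst.
  + apply: (progress_other (running_run _ _ rx)).
      by rewrite sel_put; apply: rt_trans r1 _; apply: rt_step; exact: running_moves rx oq da.
    by rewrite sel_put_neq // eq_sym.
  + congruence.
  + apply: (progress_done (running_pass rx)) => b.
    have [->|nb] := eqVneq b p; first exact: r2.
    have -> : b = ~~ p by move: nb; case: (b); case: (p).
    by split=> //; rewrite /fowner -(proj1 (rp _)).
(* After the phase has been passed on, [p] cannot move. *)
- by have [ox _ _ _] := rx; case/eqP: nn; rewrite -ox opx.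
Qed.

(** The phase ends at a position of [~~ p], and only the last stage of [progress] has that owner. *)
Lemma reach_running p x c y :
  running p p x c -> preach p x y ->
  exists2 d, running (~~ p) (~~ p) y d &
    forall b, reaches p b (self c b) (self d b).
Proof.
move=> rx [xy oy].
have : progress p c y.
  have : progress p c x by apply: progress_own rx _ _ => //; apply: rt_refl.
  move/(clos_rt_rt1n _ _ _ _): xy; elim=> // {x rx oy} x x' {}y s _ IH P.
  exact/IH/(progress_pmove P).
case=> d ry; first 3 last; first by exists d.
all: by case: ry => op *; move: oy; rewrite op; case: (p).
Qed.

(** * The winner of the product *)

Local Notation wins_on p b := (wins (@fowner _ (G b)) (@fstep _ (G b)) p).
Local Notation pwins p := (wins powner pstep p).

(* The opponent cannot stall: [p] keeps winning on track [p] and not losing on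
   track [~~ p], and after at most two phases the rank of the position on track
   [p] has decreased. *)
Lemma running_wins p r c x :
  wins_on p p (self c p) -> ~ wins_on (~~ p) (~~ p) (self c (~~ p)) ->
  running r r x c -> pwins p x.
Proof.
move: {-1}(self c p) (erefl (self c p)) => e ec w.
have np : ~~ p != p by case: (p).
(* A phase of [p]: go to [e'] on track [p] and to an undefeated position, given by
   [not_wins_escape], on the other track. *)
have own e' d y : reaches p p (self d p) e' ->
    (forall s f z, self f p = e' -> ~ wins_on (~~ p) (~~ p) (self f (~~ p)) ->
       s = ~~ p -> running s s z f -> pwins p z) ->
    ~ wins_on (~~ p) (~~ p) (self d (~~ p)) -> running p p y d -> pwins p y.
  move=> de' H nw ry; have [e'' de'' nw''] := not_wins_escape nw.
  pose f := putf (putf d p e') (~~ p) e''.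
  have fp : self f p = e' by rewrite sel_put_neq ?sel_put // eq_sym.
  have fn : self f (~~ p) = e'' by rewrite sel_put.
  have [|z yz rz] := running_reach (d := f) ry.
    move=> b; have [->|nb] := eqVneq b p; first by rewrite fp.
    have -> : b = ~~ p by move: nb; case: (b); case: (p).
    by rewrite fn.
  apply: wins_own yz _; first by case: ry.
  by apply: H rz; rewrite ?fp ?fn.
(* A phase of the opponent, who cannot reach a win on track [~~ p] whatever is played. *)
have opp d y :
    (forall f z, reaches (~~ p) p (self d p) (self f p) ->
       ~ wins_on (~~ p) (~~ p) (self f (~~ p)) -> running p p z f -> pwins p z) ->
    ~ wins_on (~~ p) (~~ p) (self d (~~ p)) -> running (~~ p) (~~ p) y d ->
    pwins p y.
  move=> H nw ry; apply: wins_opp => [|z yz]; first by case: ry.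
  have [f rz df] := reach_running ry yz.
  rewrite negbK in rz; apply: H rz; first exact: df.
  exact: not_wins_reach nw (df _).
elim: w r c x ec => {e} [e e' oe ee' _ IH | e oe _ IH] r c x ec nw rx.
- have own_e d y : self d p = e -> ~ wins_on (~~ p) (~~ p) (self d (~~ p)) ->
      running p p y d -> pwins p y.
    by move=> ed; apply: (own e'); rewrite ?ed // => s f z ef nf _; apply: IH.
  have [rp|nr] := eqVneq r p; first by subst r; apply: own_e rx.
  have er : r = ~~ p by move: nr; case: (r); case: (p).
  (* The opponent is stuck on track [p], since [e] belongs to [p]; the next phase makes the winning
     move. *)
  subst r; apply: (opp c) nw rx => f z cf nf; apply: own_e nf.
  by rewrite -ec; apply: reach_stuck cf; rewrite ec negbK.
- have opp_e d y : self d p = e -> ~ wins_on (~~ p) (~~ p) (self d (~~ p)) ->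
      running (~~ p) (~~ p) y d -> pwins p y.
    move=> ed; apply: opp => f z; rewrite ed => ef nf; exact: (IH _ ef).
  have [rp|nr] := eqVneq r p; last first.
    have er : r = ~~ p by move: nr; case: (r); case: (p).
    by subst r; apply: opp_e rx.
  (* As [e] belongs to the opponent, [p] makes the empty play on track [p] and awaits the next
     phase. *)
  subst r; apply: (own e) nw rx; first by rewrite ec; apply: reach_self.
  by move=> s f z ef nf ->; apply: opp_e.
Qed.

(** The initialising step is forced and keeps the owner, so [wins_forced] applies. *)
Lemma starting_wins p r c x :
  wins_on p p (self c p) -> ~ wins_on (~~ p) (~~ p) (self c (~~ p)) ->
  starting r x c -> pwins p x.
Proof.
move=> w nw sx; have rx := starting_init sx; set y := exec _ _ _ in rx.
apply: wins_forced (running_wins w nw rx).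
  by case: sx => ->; case: rx => ->.
case: sx => ox mx _ _ z; split=> [/pstepE|->]; last first.
  by apply/pstepE; do 4 eexists; split; last reflexivity;
    rewrite ox mx; apply: rule_init.
by case=> [a [q [qs [m [R ->]]]]]; rewrite ox mx in R; inversion R; subst.
Qed.

Definition initial_pair w : fconfigs :=
  (denote (initial (G true) w), denote (initial (G false) w)).

Lemma starting_initial w :
  starting true (denote (initial prod_ATM w)) (initial_pair w).
Proof.
split=> //; first by case.
move=> b; split; first by case: b.
(* Position 0 holds the scanned blank; the input starts at position 1. *)
case=> [|i]; first by case: b.
by case: b => /=; elim: w i => [|a w IH] [|i] //=.
Qed.

Lemma prod_accepts w :
  accepts (G true) w -> ~ rejects (G false) w -> accepts prod_ATM w.
Proof.
rewrite !acceptsE rejectsE => w1 w2.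
exact: (@starting_wins true true (initial_pair w) _ w1 w2 (starting_initial w)).
Qed.

Lemma prod_rejects w :
  rejects (G false) w -> ~ accepts (G true) w -> rejects prod_ATM w.
Proof.
rewrite acceptsE !rejectsE => w1 w2.
exact: (@starting_wins false true (initial_pair w) _ w1 w2 (starting_initial w)).
Qed.

End Product.

(** * Total machines and complementary pairs of machines *)

Theorem theorem4p2 (Sigma : finType) (L : set (seq Sigma)) :
  (exists M : ATM Sigma, total_ATM M /\ L = lang M) <->
  (exists M0 : ATM Sigma, L = lang M0) /\
  (exists N : ATM Sigma, (~` L)%classic = lang N).
Proof.
split=> [[M [tM ->]]|[[M LM] [N LN]]].
  split; first by exists M.
  (* By totality, the words outside the language are the rejected ones. *)
  exists (dual M); apply/seteqP; split=> w /=.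
    by move=> nw; apply/dual_accepts; case: (tM w).
  by move=> /dual_accepts rw aw; apply: not_accepts_rejects rw.
(* With [dual N] on track [false], the universal player wins there exactly on the words that [N]
   accepts. *)
pose P := prod_ATM (fun b : bool => if b then M else dual N).
have memM w : L w <-> accepts M w by rewrite LM.
have memN w : ~ L w <-> rejects (dual N) w.
  by rewrite dual_rejects -[accepts N w]/(lang N w) -LN.
have accP w : L w -> accepts P w.
  by move=> Lw; apply: prod_accepts => [|/memN //]; apply/memM.
have rejP w : ~ L w -> rejects P w.
  by move=> nLw; apply: prod_rejects => [|/memM //]; apply/memN.
exists P; split=> [w|]; first by have [/accP|/rejP] := EM (L w); [left|right].
apply/seteqP; split=> w; first exact: accP.
by move=> aw; apply: contrapT => /rejP; apply: not_accepts_rejects.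
Qed.
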